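(* Let $H$ be a sofic group, let $\alpha: H \curvearrowright X$ be a sofic action, and let $A \leq G$ be an inclusion of countable discrete groups such that the amalgamated free product of any countably many copies of $G$ over $A$ is sofic. Then the amalgamated free generalized wreath product $G \wr^{\ast_A}_\alpha H$ is sofic. In particular: (i) if $G, H$ are sofic groups and $\alpha: H \curvearrowright X$ is a sofic action, then the free generalized wreath product $G \wr^\ast_\alpha H$ is sofic; (ii) if $G, H$ are sofic groups, $\alpha: H \curvearrowright X$ is a sofic action, and $A$ is an amenable subgroup of $G$, then the amalgamated free generalized wreath product $G \wr^{\ast_A}_\alpha H$ is sofic.
   Context: For a nonempty finite set $C$, $\mathrm{Sym}(C)$ is the group of permutations of $C$, with the normalized Hamming distance $d(\sigma,\tau) = |\{c \in C : \sigma(c) \neq \tau(c)\}|/|C|$. Let $\Gamma$ be a countable discrete group, $C$ a finite set, and $\varphi: \Gamma \to \mathrm{Sym}(C)$ a map (not necessarily a homomorphism). $\varphi$ is unital if $\varphi(1_\Gamma) = 1$. For finite $F \subseteq \Gamma$ and $\epsilon > 0$, $\varphi$ is $(F,\epsilon)$-multiplicative if $d(\varphi(gh), \varphi(g)\varphi(h)) < \epsilon$ for all $g,h \in F$. A countable discrete group $\Gamma$ is sofic if for all finite $F \subseteq \Gamma$ and $\epsilon > 0$ there exist a finite set $C$ and a map $\varphi: \Gamma \to \mathrm{Sym}(C)$ which is unital, $(F,\epsilon)$-multiplicative, and satisfies $d(1,\varphi(g)) > 1-\epsilon$ for all $g \in F \setminus \{1_\Gamma\}$. Let $\alpha: \Gamma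 \curvearrowright X$ be an action of a countable discrete group on a countable discrete set. For finite $F \subseteq \Gamma$, finite $E \subseteq X$ and $\epsilon > 0$, a map $\varphi: \Gamma \to \mathrm{Sym}(C)$ is an $(F,E,\epsilon)$-orbit approximation of $\alpha$ if there exist a finite set $B$ and a subset $S \subseteq C$ with $|S| > (1-\epsilon)|C|$ and, for each $s \in S$, an injective map $\pi_s: E \hookrightarrow B$, such that $\pi_{\varphi(g)s}(x) = \pi_s(\alpha(g^{-1})x)$ for all $s \in S$, $g \in F$, $x \in E$ whenever $\varphi(g)s \in S$ and $\alpha(g^{-1})x \in E$. The action $\alpha$ is sofic if for all finite $F \subseteq \Gamma$, finite $E \subseteq X$ and $\epsilon > 0$ there exist a finite set $C$ and a map $\varphi: \Gamma \to \mathrm{Sym}(C)$ which is unital, $(F,\epsilon)$-multiplicative, and an $(F,E,\epsilon)$-orbit approximation of $\alpha$. For groups $G,H$, an action $\alpha: H \curvearrowright X$ on a set, and a subgroup $A \leq G$, let $\ast_A^{x \in X} G_x$ be the amalgamated free product over $A$ of copies $G_x$ of $G$ indexed by $x \in X$. $H$ acts on it by an action $\beta$ permuting the copies $G_x$ according to $\alpha$ (i.e. $\beta(h)$ sends the copy of $g \in G$ in $G_x$ to the copy of $g$ in $G_{\alpha(h)x}$). The amalgamated free generalized wreath product is $G \wr^{\ast_A}_\alpha H = (\ast_A^{x \in X} G_x) \rtimes_\beta H$. When $A = \{1_G\}$ it is called the free generalized wreath product and denoted $G \wr^\ast_\alpha H$. *)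

(* Defs.v *)
From HB Require Import structures.
From mathcomp Require Import all_boot all_order all_algebra perm finmap.
From mathcomp Require Import boolp classical_sets functions cardinality reals.

Set Implicit Arguments.
Unset Strict Implicit.
Unset Printing Implicit Defensive.

Import Order.TTheory GRing.Theory Num.Theory.

Local Open Scope fset_scope.
Local Open Scope ring_scope.
Local Open Scope quotient_scope.

Record laction (H : groupType) (X : Type) := LAction {
  lact :> H -> X -> X;
  lact1 : forall x, lact 1%g x = x;
  lactM : forall g h x, lact (g * h)%g x = lact g (lact h x) }.

Record autaction (H N : groupType) := AutAction {
  autact :> laction H N;
  autactM : forall h, {morph autact h : n m / (n * m)%g >-> (n * m)%g} }.

Section Soficity.
Variable R : realType.

Definition hamming (C : finType) (s t : {perm C}) : R :=
  #|[set c | s c != t c]|%:R / #|C|%:R.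

Definition unital (G : groupType) (C : finType) (phi : G -> {perm C}) : Prop :=
  phi 1%g = 1%g.

(* [permM] says (s * t) c = t (s c), so the composite of permutations that    *)
(* first applies phi h and then phi g is phi h * phi g.                       *)
Definition multiplicative_on (G : groupType) (C : finType)
    (F : {fset G}) (eps : R) (phi : G -> {perm C}) : Prop :=
  forall g h, g \in F -> h \in F ->
    hamming (phi (g * h)%g) (phi h * phi g)%g < eps.

Definition sofic (G : groupType) : Prop :=
  countable [set: G] /\
  forall (F : {fset G}) (eps : R), 0 < eps ->
    exists (C : finType) (phi : G -> {perm C}),
      [/\ (0 < #|C|)%N, unital phi, multiplicative_on F eps phi &
          forall g, g \in F -> g != 1%g -> hamming 1%g (phi g) > 1 - eps].

(* Only the values of pi_ s on E matter, and only for s in S.                 *)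
Definition orbit_approximation (G : groupType) (X : choiceType)
    (alpha : laction G X) (F : {fset G}) (E : {fset X}) (eps : R)
    (C : finType) (phi : G -> {perm C}) : Prop :=
  exists (B : finType) (S : {set C}) (pi_ : C -> X -> B),
    [/\ (1 - eps) * #|C|%:R < #|S|%:R,
        forall s, s \in S -> {in E &, injective (pi_ s)} &
        forall s g x, s \in S -> g \in F -> x \in E ->
          phi g s \in S -> alpha g^-1%g x \in E ->
          pi_ (phi g s) x = pi_ s (alpha g^-1%g x)].

Definition sofic_action (G : groupType) (X : choiceType)
    (alpha : laction G X) : Prop :=
  [/\ countable [set: G], countable [set: X] &
  forall (F : {fset G}) (E : {fset X}) (eps : R), 0 < eps ->
    exists (C : finType) (phi : G -> {perm C}),
      [/\ (0 < #|C|)%N, unital phi, multiplicative_on F eps phi &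
          orbit_approximation alpha F E eps phi]].

(* Amenability of a discrete group, via Folner sets.                          *)
Definition amenable (G : groupType) : Prop :=
  forall (F : {fset G}) (eps : R), 0 < eps ->
    exists2 K : {fset G}, K != fset0 &
      forall g, g \in F ->
        let gK := [fset (g * k)%g | k in K] in
        #|` (gK `\` K) `|` (K `\` gK)|%:R < eps * #|` K|%:R.

End Soficity.

Section Subgroups.
Variable G : groupType.

Definition subgroup (A : groupClosed G) : Type := {x : G | x \in A}.

Section SubgroupGroup.
Variable A : groupClosed G.

HB.instance Definition _ := SubChoice.on (subgroup A).

Fact subgroup_closed : group_closed (A : {pred G}).
Proof. by split; [exact: gpred1 | exact: gpredF]. Qed.

HB.instance Definition _ :=
  SubChoice_isSubGroup.Build G (fun x => x \in A) (subgroup A) subgroup_closed.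

End SubgroupGroup.

Definition trivial_subgroup : {pred G} := pred1 1%g.

Fact trivial_mulg_closed : mulg_closed trivial_subgroup.
Proof. by move=> x y /eqP -> /eqP ->; rewrite mulg1 inE. Qed.
Fact trivial_gpred1 : 1%g \in trivial_subgroup.
Proof. by rewrite inE. Qed.
Fact trivial_invg_closed : invg_closed trivial_subgroup.
Proof. by move=> x /eqP ->; rewrite invg1 inE. Qed.

HB.instance Definition _ := isMulClosed.Build G trivial_subgroup
  trivial_mulg_closed.
HB.instance Definition _ := isMul1Closed.Build G trivial_subgroup
  trivial_gpred1.
HB.instance Definition _ := isInvClosed.Build G trivial_subgroup
  trivial_invg_closed.

End Subgroups.

(* The amalgamated free product over A of copies G_x (x : X) of G, presented  *)
(* by words: the letter inl a is a in A and the letter inr (x, g) is the copy *)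
(* of g in G_x. The letters inl a are redundant when X is inhabited; they     *)
(* make the product over an empty X equal to A, the empty pushout under A.    *)
Section AmalgamatedFreeProduct.
Variables (G : groupType) (A : groupClosed G) (X : choiceType).

Definition amalg_letter : Type := (subgroup A + X * G)%type.
HB.instance Definition _ := Choice.on amalg_letter.

Inductive amalg_cong : seq amalg_letter -> seq amalg_letter -> Prop :=
| amalg_refl u : amalg_cong u u
| amalg_sym u v : amalg_cong u v -> amalg_cong v u
| amalg_trans v u w : amalg_cong u v -> amalg_cong v w -> amalg_cong u w
| amalg_cat u u' v v' :
    amalg_cong u u' -> amalg_cong v v' -> amalg_cong (u ++ v) (u' ++ v')
| amalg_base1 : amalg_cong [:: inl 1%g] [::]
| amalg_baseM (a b : subgroup A) :
    amalg_cong [:: inl a; inl b] [:: inl (a * b)%g]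
| amalg_copy1 x : amalg_cong [:: inr (x, 1%g)] [::]
| amalg_copyM x g h :
    amalg_cong [:: inr (x, g); inr (x, h)] [:: inr (x, (g * h)%g)]
| amalg_glue x (a : subgroup A) :
    amalg_cong [:: inl a] [:: inr (x, val a)].

Definition amalg_rel : rel (seq amalg_letter) :=
  fun u v => `[< amalg_cong u v >].

Fact amalg_rel_refl : reflexive amalg_rel.
Proof. by move=> u; apply/asboolP; exact: amalg_refl. Qed.
Fact amalg_rel_sym : symmetric amalg_rel.
Proof. by move=> u v; apply/asboolP/asboolP => /amalg_sym. Qed.
Fact amalg_rel_trans : transitive amalg_rel.
Proof.
by move=> v u w /asboolP uv /asboolP vw; apply/asboolP; exact: amalg_trans vw.
Qed.

Canonical amalg_equiv :=
  EquivRel amalg_rel amalg_rel_refl amalg_rel_sym amalg_rel_trans.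

Definition amalg : Type := {eq_quot amalg_rel}.
HB.instance Definition _ := Choice.on amalg.
HB.instance Definition _ := Quotient.on amalg.

Lemma amalg_piP u v : \pi_amalg u = \pi_amalg v <-> amalg_cong u v.
Proof.
split=> [uv|/asboolP uv]; last by apply/eqmodP.
by apply/asboolP; apply/(@eqmodP _ amalg_equiv).
Qed.

Lemma amalg_reprK u : amalg_cong (repr (\pi_amalg u)) u.
Proof. by apply/amalg_piP; rewrite reprK. Qed.

Definition inv_letter (l : amalg_letter) : amalg_letter :=
  match l with
  | inl a => inl a^-1%g
  | inr (x, g) => inr (x, g^-1%g)
  end.

Definition inv_word (u : seq amalg_letter) : seq amalg_letter :=
  rev (map inv_letter u).

Definition amalg_one : amalg := \pi_amalg [::].
Definition amalg_mul (p q : amalg) : amalg := \pi_amalg (repr p ++ repr q).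
Definition amalg_inv (p : amalg) : amalg := \pi_amalg (inv_word (repr p)).

Lemma inv_letterK l : inv_letter (inv_letter l) = l.
Proof. by case: l => [a|[x g]] /=; rewrite invgK. Qed.

Lemma inv_wordK u : inv_word (inv_word u) = u.
Proof.
by rewrite /inv_word map_rev revK -map_comp map_id_in // => l _; exact: inv_letterK.
Qed.

Lemma inv_letter_cong l : amalg_cong [:: inv_letter l; l] [::].
Proof.
case: l => [a|[x g]] /=.
  by apply: amalg_trans (amalg_baseM _ _) _; rewrite mulVg; exact: amalg_base1.
by apply: amalg_trans (amalg_copyM _ _ _) _; rewrite mulVg; exact: amalg_copy1.
Qed.

Lemma inv_word_cong u : amalg_cong (inv_word u ++ u) [::].
Proof.
elim: u => [|l u IH]; first exact: amalg_refl.
rewrite /inv_word /= rev_cons cat_rcons -[inv_letter l :: _]/([:: _; _] ++ u).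
apply: amalg_trans IH; apply: amalg_cat; first exact: amalg_refl.
apply: (@amalg_cat _ [::] _ u); first exact: inv_letter_cong.
exact: amalg_refl.
Qed.

Fact amalg_mulA : associative amalg_mul.
Proof.
move=> p q r; apply/amalg_piP.
apply: (@amalg_trans (repr p ++ (repr q ++ repr r))).
  by apply: amalg_cat (amalg_refl _) (amalg_reprK _).
rewrite catA; apply/amalg_sym.
by apply: amalg_cat (amalg_reprK _) (amalg_refl _).
Qed.

Fact amalg_mul1 : left_id amalg_one amalg_mul.
Proof.
move=> p; rewrite -{2}[p]reprK; apply/amalg_piP.
exact: amalg_cat (amalg_reprK [::]) (amalg_refl _).
Qed.

Fact amalg_1mul : right_id amalg_one amalg_mul.
Proof.
move=> p; rewrite -{2}[p]reprK; apply/amalg_piP.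
rewrite -{2}[repr p]cats0.
exact: amalg_cat (amalg_refl _) (amalg_reprK [::]).
Qed.

Fact amalg_mulV : left_inverse amalg_one amalg_inv amalg_mul.
Proof.
move=> p; apply/amalg_piP; apply: amalg_trans (inv_word_cong (repr p)).
exact: amalg_cat (amalg_reprK _) (amalg_refl _).
Qed.

Fact amalg_Vmul : right_inverse amalg_one amalg_inv amalg_mul.
Proof.
move=> p; apply/amalg_piP; apply: amalg_trans (_ : amalg_cong (repr p ++ inv_word (repr p)) _).
  exact: amalg_cat (amalg_refl _) (amalg_reprK _).
by rewrite -{1}[repr p]inv_wordK; exact: inv_word_cong.
Qed.

HB.instance Definition _ := isGroup.Build amalg
  amalg_mulA amalg_mul1 amalg_1mul amalg_mulV amalg_Vmul.

End AmalgamatedFreeProduct.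

Arguments amalg {G} A X.

Section CopyAction.
Variables (G H : groupType) (A : groupClosed G) (X : choiceType).
Variable alpha : laction H X.

Definition copy_letter (h : H) (l : amalg_letter A X) : amalg_letter A X :=
  match l with
  | inl a => inl a
  | inr (x, g) => inr (alpha h x, g)
  end.

Definition copy_map (h : H) (p : amalg A X) : amalg A X :=
  \pi_(amalg A X) (map (copy_letter h) (repr p)).

Lemma copy_cong h u v :
  amalg_cong u v -> amalg_cong (map (copy_letter h) u) (map (copy_letter h) v).
Proof.
elim=> {u v} [u|u v _|v u w _ uv _ vw|u u' v v' _ uu' _ vv'||a b|x|x g g'|x a] /=.
- exact: amalg_refl.
- exact: amalg_sym.
- exact: amalg_trans vw.
- by rewrite !map_cat; exact: amalg_cat.
- exact: amalg_base1.
- exact: amalg_baseM.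
- exact: amalg_copy1.
- exact: amalg_copyM.
- exact: amalg_glue.
Qed.

Lemma copy_map_pi h u :
  copy_map h (\pi_(amalg A X) u) = \pi_(amalg A X) (map (copy_letter h) u).
Proof. by apply/amalg_piP/copy_cong; exact: amalg_reprK. Qed.

Fact copy_map1 p : copy_map 1%g p = p.
Proof.
rewrite -[p]reprK copy_map_pi map_id_in // => -[a|[x g]] _ //=.
by rewrite lact1.
Qed.

Fact copy_map_comp g h p : copy_map (g * h)%g p = copy_map g (copy_map h p).
Proof.
rewrite -[p]reprK (copy_map_pi h) !copy_map_pi -map_comp.
by congr (\pi_(amalg A X) _); apply: eq_map => -[a|[x k]] //=; rewrite lactM.
Qed.

Fact copy_mapM h : {morph copy_map h : p q / (p * q)%g >-> (p * q)%g}.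
Proof.
move=> p q; apply/amalg_piP.
apply: amalg_trans (copy_cong _ (amalg_reprK _)) _; rewrite map_cat.
by apply: amalg_sym; apply: amalg_cat; exact: amalg_reprK.
Qed.

Definition copy_action : autaction H (amalg A X) :=
  AutAction (autact := LAction copy_map1 copy_map_comp) copy_mapM.

End CopyAction.

Arguments copy_action {G H} A {X} alpha.

(* The pair (n, h) stands for the product n h, so that h n h^-1 = beta h n;   *)
(* the type depends on beta only to carry the group law.                      *)
Definition semidirect (N H : groupType) (beta : autaction H N) : Type :=
  (N * H)%type.

Section SemidirectProduct.
Variables (N H : groupType) (beta : autaction H N).

Local Notation semidirect := (semidirect beta).

HB.instance Definition _ := Choice.copy semidirect (N * H)%type.

Definition semidirect_one : semidirect := (1%g, 1%g).
Definition semidirect_mul (p q : semidirect) : semidirect :=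
  ((p.1 * beta p.2 q.1)%g, (p.2 * q.2)%g).
Definition semidirect_inv (p : semidirect) : semidirect :=
  (beta p.2^-1%g p.1^-1%g, p.2^-1%g).

Lemma autact1 h : beta h 1%g = 1%g.
Proof. by apply: (mulgI (beta h 1%g)); rewrite -autactM !mulg1. Qed.

Fact semidirect_mulA : associative semidirect_mul.
Proof.
by move=> [n g] [m h] [k l]; rewrite /semidirect_mul /= autactM lactM !mulgA.
Qed.
Fact semidirect_mul1 : left_id semidirect_one semidirect_mul.
Proof. by move=> [n h]; rewrite /semidirect_mul /= lact1 !mul1g. Qed.
Fact semidirect_1mul : right_id semidirect_one semidirect_mul.
Proof. by move=> [n h]; rewrite /semidirect_mul /= autact1 !mulg1. Qed.
Fact semidirect_mulV : left_inverse semidirect_one semidirect_inv semidirect_mul.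
Proof.
by move=> [n h]; rewrite /semidirect_mul /= -autactM !mulVg autact1.
Qed.
Fact semidirect_Vmul :
  right_inverse semidirect_one semidirect_inv semidirect_mul.
Proof.
by move=> [n h]; rewrite /semidirect_mul /= -lactM !mulgV lact1 mulgV.
Qed.

HB.instance Definition _ := isGroup.Build semidirect
  semidirect_mulA semidirect_mul1 semidirect_1mul
  semidirect_mulV semidirect_Vmul.

End SemidirectProduct.

Definition amalgamated_wreath (G H : groupType) (A : groupClosed G)
    (X : choiceType) (alpha : laction H X) : groupType :=
  semidirect (copy_action A alpha).

Definition free_wreath (G H : groupType) (X : choiceType)
    (alpha : laction H X) : groupType :=
  @amalgamated_wreath G H (@trivial_subgroup G) X alpha.

Arguments amalgamated_wreath {G H} A {X} alpha.
Arguments free_wreath G {H X} alpha.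

(* Main.v *)
Require Import Defs.
From HB Require Import structures.
From mathcomp Require Import all_boot all_order all_algebra perm finmap.
From mathcomp Require Import boolp classical_sets functions cardinality reals.
From mathcomp Require Import lra zify.

(******************************************************************************)
(* Wreath products. Let phi : H -> Sym(C) be an orbit approximation of alpha, *)
(* with injections pi_c into a finite set B, and let psi be a sofic           *)
(* approximation of the amalgam over B, with values in Sym(D). The formula    *)
(*   (n, h) . (c, d) = (phi(h) c, psi(pi_{phi(h) c}(n)) d)                    *)
(* is almost multiplicative, since pi_{phi(h) c} o beta_h = pi_c on a finite  *)
(* set of elements, for most c. Taking the product of phi with a sofic        *)
(* approximation of H makes it free.                                          *)
(*                                                                            *)
(* Amalgams over an amenable A. The group G has sofic approximations on       *)
(* partitioned sets such that most points stay in their block under a in A    *)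
(* and leave it under g not in A. They arise by carving in random order:      *)
(* given a Folner set K of A, assign to c the first element of                *)
(* { k^-1 c | k in K } for a random order; c and a c then separate with       *)
(* probability at most |K symdiff a^-1 K| / |K|. Let g in the copy G_x act on *)
(* C x D as T_x g T_x^-1, where T_x(c, d) = (c, t_(x, block c) d) and the t_z *)
(* are involutions of D without short relations other than t_z^2 = 1.         *)
(* Elements of A respect the blocks, hence commute with T_x up to a small     *)
(* error, and a reduced word of the amalgam moves d by a word in the t_z      *)
(* whose consecutive letters differ.                                          *)
(******************************************************************************)

Set Implicit Arguments.
Unset Strict Implicit.
Unset Printing Implicit Defensive.

(** * Densities and pointwise soficity *)

(** For most points c of a finite model of H, [pi_ c] embeds a given finite part of X into a finite
    set B, compatibly with the action. Hence [amalg_map (pi_ c)] carries finitely many elements of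
    the amalgam over X into the amalgam over B, which has a finite model D by hypothesis, and the
    skew product with fibre D is a model of the wreath product. Multiplicativity is [wreath_permM],
    by the equivariance [amalg_map_copy]; elements with trivial H-part move points by
    [amalg_map_eq1]; [sofic_wreath] adds up the errors.

    Case (ii) follows from soficity of the amalgam over an amenable A, [sofic_amalg], and case (i)
    is case (ii) for the trivial subgroup. For [sofic_amalg], G gets models with blocks that look
    locally like A-orbits ([sofic_amenable_partition]). The defining relations then hold
    approximately ([eventually_cong]), every nontrivial element is represented by a normal word
    ([normal_word_ex]), and such a word moves most points ([eventually_moves]), because the
    involutions of [free_involutions] satisfy no short reduced relation. *)

Section Density.
Import Order.TTheory GRing.Theory Num.Theory.
Local Open Scope ring_scope.
Variable R : realType.
Implicit Types C D : finType.

Definition density C (A : {set C}) : R := #|A|%:R / #|C|%:R.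

Lemma density_ge0 C (A : {set C}) : 0 <= density A.
Proof. by rewrite divr_ge0 ?ler0n. Qed.

Lemma densityS C (A B : {set C}) : A \subset B -> density A <= density B.
Proof.
by move=> sAB; rewrite ler_wpM2r ?invr_ge0 ?ler0n // ler_nat subset_leq_card.
Qed.

Lemma density0 C : density (finset.set0 : {set C}) = 0.
Proof. by rewrite /density cards0 mul0r. Qed.

Lemma densityU C (A B : {set C}) : density (A :|: B) <= density A + density B.
Proof.
by rewrite -mulrDl ler_wpM2r ?invr_ge0 ?ler0n // -natrD ler_nat leq_card_setU.
Qed.

Lemma densityC C (A : {set C}) :
  (0 < #|C|)%N -> density (~: A) = 1 - density A.
Proof.
move=> C0; have C1 : #|C|%:R != 0 :> R by rewrite pnatr_eq0 -lt0n.
apply: (mulIf C1); rewrite mulrBl mul1r /density !divfK //.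
by apply/eqP; rewrite eq_sym subr_eq addrC -natrD cardsC.
Qed.

Lemma density_preim C (s : {perm C}) (A : {set C}) :
  density (s @^-1: A) = density A.
Proof. by rewrite /density card_preimset //; exact: perm_inj. Qed.

Lemma density_has C (T : eqType) (r : seq T) (P : T -> pred C) e :
  {in r, forall x, density [set c | P x c] <= e} ->
  density [set c | has (P^~ c) r] <= e *+ size r.
Proof.
elim: r => [|x r IH] Pe /=.
  by rewrite (_ : [set _ | _] = finset.set0) ?density0.
rewrite mulrS; apply: le_trans (lerD (Pe x _) (IH _)); rewrite ?mem_head //.
  apply: le_trans (densityU _ _); apply: densityS; apply/fintype.subsetP => c.
  by rewrite !inE.
by move=> y yr; apply: Pe; rewrite inE yr orbT.
Qed.

(** Counting fibrewise, the fibres over [A] may be full; this is the estimate used for all skew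
    products below. *)
Lemma density_fibre C D (A : {set C}) (B : {set C * D}) e :
  0 <= e ->
  (forall c, c \notin A -> density [set d | (c, d) \in B] <= e) ->
  density B <= density A + e.
Proof.
move=> e0 Be; have [CD0|CD0] := posnP #|{: C * D}|.
  by rewrite {1}/density CD0 invr0 mulr0 addr_ge0 ?density_ge0.
move: CD0; rewrite card_prod muln_gt0 => /andP[C0 D0].
have C0R : 0 < #|C|%:R :> R by rewrite ltr0n.
have D0R : 0 < #|D|%:R :> R by rewrite ltr0n.
rewrite /density ler_pdivrMr ?card_prod ?natrM ?mulr_gt0 // mulrDl.
rewrite mulrA divfK ?gt_eqF //.
have -> : #|B| = (\sum_(c : C) #|[set d | (c, d) \in B]|)%N.
  rewrite -sum1_card (eq_bigr (fun p => (fun c d => 1%N) p.1 p.2)) //.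
  rewrite (eq_bigl (fun p => predT p.1 && ((p.1, p.2) \in B))) => [|[]//].
  rewrite -(pair_big_dep predT (fun c d => (c, d) \in B) (fun _ _ => 1%N)) /=.
  apply: eq_bigr => c _; rewrite -sum1_card.
  by apply: eq_bigl => d; rewrite inE.
rewrite natr_sum (bigID (mem A)) /= lerD //.
  rewrite -sum1_card natr_sum mulr_suml ler_sum // => c _.
  by rewrite mul1r ler_nat max_card.
apply: (@le_trans _ _ (\sum_(c | c \notin A) e * #|D|%:R)).
  by apply: ler_sum => c /Be; rewrite /density ler_pdivrMr.
rewrite sumr_const -[leLHS]mulr_natl mulrCA ler_wpM2l // ler_wpM2r ?ler0n //.
by rewrite ler_nat max_card.
Qed.

Lemma hamming_sym C (s t : {perm C}) : hamming R s t = hamming R t s.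
Proof. by congr (_%:R / _); apply: eq_card => c; rewrite !inE eq_sym. Qed.

Lemma hamming_triangle C (t s u : {perm C}) :
  hamming R s u <= hamming R s t + hamming R t u.
Proof.
apply: le_trans (densityU _ _); apply: densityS; apply/fintype.subsetP => c.
rewrite !inE; apply: contraR; rewrite negb_or !negbK => /andP[/eqP -> /eqP ->].
by [].
Qed.

Lemma hamming_mulr C (s t u : {perm C}) :
  hamming R (s * u) (t * u) = hamming R s t.
Proof.
by congr (_%:R / _); apply: eq_card => c; rewrite !inE !permM (inj_eq perm_inj).
Qed.

Lemma hamming_mull C (u s t : {perm C}) :
  hamming R (u * s) (u * t) = hamming R s t.
Proof.
rewrite -[RHS](density_preim u); congr (_%:R / _).
by apply: eq_card => c; rewrite !inE !permM.
Qed.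

Lemma hamming1E C (s : {perm C}) :
  (0 < #|C|)%N -> hamming R 1 s = 1 - density [set c | s c == c].
Proof.
move=> C0; rewrite -densityC //; congr (_%:R / _); apply: eq_card => c.
by rewrite !inE perm1 eq_sym.
Qed.

End Density.

Section Soficity.
Import Order.TTheory GRing.Theory Num.Theory.
Local Open Scope ring_scope.
Variable R : realType.

(** Soficity at one point: away from a small set, the approximate identities become exact
    equations. *)
Definition sofic_at (G : groupType) (C : finType) (F : {fset G})
    (s : G -> {perm C}) (c : C) : bool :=
  all (fun g => all (fun h => s (g * h)%g c == s g (s h c)) F &&
                ((g == 1%g) || (s g c != c))) F.

Lemma sofic_atM (G : groupType) (C : finType) (F : {fset G})
    (s : G -> {perm C}) c g h :
  sofic_at F s c -> g \in F -> h \in F -> s (g * h)%g c = s g (s h c).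
Proof. by move=> /allP H /H /andP[/allP{}H _] /H /eqP. Qed.

Lemma sofic_at_free (G : groupType) (C : finType) (F : {fset G})
    (s : G -> {perm C}) c g :
  sofic_at F s c -> g \in F -> g != 1%g -> s g c != c.
Proof. by move=> /allP H /H /andP[_] /orP[->|]. Qed.

Lemma sofic_pointwise (G : groupType) (F : {fset G}) (e : R) :
  sofic R G -> 0 < e ->
  exists (C : finType) (s : G -> {perm C}),
    [/\ (0 < #|C|)%N, s 1%g = 1%g & density R [set c | ~~ sofic_at F s c] < e].
Proof.
move=> [_ sG] e0.
(* Each g in [F] has at most [n] ways to fail: one per product g h, and one for fixing a point. *)
pose n := (#|` F|.+1)%N; pose e' := e / (n ^ 2).*2%:R.
have n0 : 0 < (n ^ 2).*2%:R :> R by rewrite ltr0n double_gt0.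
have e'0 : 0 < e' by rewrite divr_gt0.
have [C [s [C0 s1 sM sF]]] := sG F e' e'0; exists C, s; split => //.
have bad g : g \in F ->
    density R [set c | ~~ (all (fun h => s (g * h)%g c == s g (s h c)) F &&
                ((g == 1%g) || (s g c != c)))] <= e' *+ n.
  move=> gF; rewrite /n mulrSr.
  apply: (@le_trans _ _ (density R [set c | has (fun h => s (g * h)%g c != s g (s h c)) F]
     + density R [set c | (g != 1%g) && (s g c == c)])).
    apply: le_trans (densityU _ _ _); apply: densityS; apply/fintype.subsetP=> c.
    by rewrite !inE negb_and negb_or negbK -has_predC.
  apply: lerD.
    apply: density_has => h hF; apply/ltW.
    have := sM _ _ gF hF; rewrite /hamming => sgh.
    by under eq_finset => c do rewrite -permM.
  have [g1|g1] := eqVneq g 1%g.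
    by rewrite (_ : [set _ | _] = finset.set0) ?density0 ?ltW //.
  have := sF _ gF g1; rewrite hamming1E // => /ltW.
  by rewrite lerD2l lerN2; apply: le_trans; apply: densityS; apply/fintype.subsetP.
under eq_finset => c do rewrite /sofic_at -has_predC.
apply: le_lt_trans (density_has bad) _; rewrite -mulrnA -mulr_natr /e'.
rewrite mulrAC -[ltRHS]mulr1 -mulrA ltr_pM2l // ltr_pdivrMr // mul1r ltr_nat.
rewrite -addnn; apply: (@leq_ltn_trans (n ^ 2)%N); last first.
  by rewrite -[X in (X < _)%N]addn0 ltn_add2l.
by rewrite leq_mul2l leqnSn orbT.
Qed.

End Soficity.

(** * Random orders *)

Section Twist.
Variables (C D : finType).

Definition twist_fun (f : {perm C}) (k : C -> {perm D}) (p : C * D) : C * D :=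
  (f p.1, k p.1 p.2).

Lemma twist_inj f k : injective (twist_fun f k).
Proof. by move=> [c d] [c' d'] [/perm_inj <- /perm_inj <-]. Qed.

Definition twist f k : {perm C * D} := perm (@twist_inj f k).

Lemma twistE f k c d : twist f k (c, d) = (f c, k c d).
Proof. by rewrite permE. Qed.

End Twist.

Section FirstElement.
Variable C : finType.
Implicit Types (U V : {set C}) (w : {perm C}).

(* The permutation w orders C by pulling back the order of [enum C]. *)
Definition first_in U w : option C :=
  [pick c in U | [forall d in U, (enum_rank (w c) <= enum_rank (w d))%N]].

Lemma first_in_eqP U w c :
  reflect (c \in U /\ {in U, forall d, (enum_rank (w c) <= enum_rank (w d))%N})
          (first_in U w == Some c).
Proof.
apply: (iffP eqP); rewrite /first_in.
  by case: pickP => // x /andP[xU /forall_inP xw] [<-].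
move=> [cU cw]; case: pickP => [x /andP[xU /forall_inP xw]|].
  congr Some; apply: (@perm_inj _ w); apply: enum_rank_inj; apply: val_inj.
  by apply/eqP; rewrite eqn_leq xw //= cw.
by move/(_ c); rewrite cU /= => /negP[]; apply/forall_inP.
Qed.

Lemma first_in_mem U w c : first_in U w = Some c -> c \in U.
Proof. by move/eqP/first_in_eqP => []. Qed.

Lemma first_in_sub U V w c :
  V \subset U -> c \in V -> first_in U w = Some c -> first_in V w = Some c.
Proof.
move=> /fintype.subsetP sVU cV /eqP/first_in_eqP[_ cU]; apply/eqP/first_in_eqP.
by split=> // d /sVU; exact: cU.
Qed.

Lemma first_in_ex U w : U != finset.set0 -> exists2 c, c \in U & first_in U w = Some c.
Proof.
case/finset.set0Pn => c0 c0U.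
case: (@arg_minnP _ c0 (mem U) (fun c => enum_rank (w c)) c0U) => c cU cm.
by exists c => //; apply/eqP/first_in_eqP.
Qed.

Lemma first_in_tperm U w c d : c \in U -> d \in U ->
  first_in U w = Some c -> first_in U (tperm c d * w)%g = Some d.
Proof.
move=> cU dU /eqP/first_in_eqP[_ cw]; apply/eqP/first_in_eqP; split=> // e eU.
by rewrite !permM tpermR cw //; case: tpermP.
Qed.

Lemma card_first_in_const U c d : c \in U -> d \in U ->
  #|[set w | first_in U w == Some c]| = #|[set w | first_in U w == Some d]|.
Proof.
suff le a b : a \in U -> b \in U ->
    (#|[set w | first_in U w == Some a]| <= #|[set w | first_in U w == Some b]|)%N.
  by move=> cU dU; apply/eqP; rewrite eqn_leq !le.
move=> aU bU; rewrite -(card_imset _ (mulgI (tperm a b))).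
apply: subset_leq_card; apply/fintype.subsetP => _ /imsetP[w /[!inE] /eqP wa ->].
by rewrite (first_in_tperm aU bU wa).
Qed.

(** By the transposition symmetry [card_first_in_const], the first element of [U] is uniformly
    distributed over [U]. *)
Lemma card_first_in U V : V \subset U ->
  (#|[set w | [exists c in V, first_in U w == Some c]]| * #|U| =
   #|V| * #|{perm C}|)%N.
Proof.
move=> sVU; have sVU' := fintype.subsetP sVU.
have [U0|/finset.set0Pn[u uU]] := eqVneq U finset.set0.
  by move: sVU; rewrite U0 finset.subset0 => /eqP ->; rewrite !cards0 muln0 mul0n.
have Un0 : U != finset.set0 by apply/finset.set0Pn; exists u.
pose m := #|[set w | first_in U w == Some u]|.
have cardW (W : {set C}) : W \subset U ->
    #|[set w | [exists c in W, first_in U w == Some c]]| = (#|W| * m)%N.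
  move/fintype.subsetP => sWU.
  rewrite -sum1_card.
  rewrite (partition_big (fun w => odflt u (first_in U w)) (mem W)) /=; last first.
    by move=> w; rewrite inE => /exists_inP[c cW /eqP ->].
  rewrite -sum_nat_const; apply: eq_bigr => c cW.
  rewrite /m -(card_first_in_const (sWU c cW) uU) -sum1_card; apply: eq_bigl => w.
  rewrite !inE; apply/andP/eqP => [[/exists_inP[d _ /eqP ->] /eqP <- //]|-> /=].
  by split=> //; apply/exists_inP; exists c.
have := cardW U; rewrite (_ : [set w | _] = finset.setT) => [/(_ (fintype.subxx _))|].
  rewrite cardsT => ->; rewrite cardW //; lia.
apply/finset.setP => w; rewrite !inE; apply/exists_inP.
by have [c cU /eqP cw] := first_in_ex w Un0; exists c.
Qed.

(* If the first element of U :|: V lies in both U and V, it is first in both. *)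
Lemma first_in_neq_card U V :
  (#|[set w | first_in U w != first_in V w]| * #|U :|: V| <=
   #|(U :\: V) :|: (V :\: U)| * #|{perm C}|)%N.
Proof.
rewrite -(@card_first_in (U :|: V)) ?leq_mul2r; last first.
  by rewrite finset.subUset
     (fintype.subset_trans (finset.subsetDl _ _) (finset.subsetUl _ _))
     (fintype.subset_trans (finset.subsetDl _ _) (finset.subsetUr _ _)).
apply/orP; right; apply: subset_leq_card; apply/fintype.subsetP => w; rewrite !inE.
apply: contraR => /exists_inPn H.
have [UV0|UV0] := eqVneq (U :|: V) finset.set0.
  move/eqP: UV0; rewrite finset.setU_eq0 => /andP[/eqP -> /eqP ->]; exact: eqxx.
have [c cUV cw] := first_in_ex w UV0.
have cI : c \in U :&: V.
  apply/negPn/negP => cI; suff /H : c \in (U :\: V) :|: (V :\: U) by rewrite cw eqxx.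
  by move: cI cUV; rewrite !inE; do 2!case: (c \in _).
move: cI; rewrite inE => /andP[cU cV]; apply/eqP.
by rewrite (first_in_sub (finset.subsetUl _ _) cU cw)
  (first_in_sub (finset.subsetUr _ _) cV cw).
Qed.

End FirstElement.

(** * Partitioned sofic approximations *)

Section Partition.
Import Order.TTheory GRing.Theory Num.Theory.
Local Open Scope ring_scope.
Variable R : realType.

(** If p and q agreed at c, then p^-1 q would fix c, against freeness at c. *)
Lemma sofic_at_inj (G : groupType) (C : finType) (F : {fset G})
    (s : G -> {perm C}) c p q :
  s 1%g = 1%g -> sofic_at F s c ->
  p \in F -> q \in F -> p^-1%g \in F -> (p^-1 * q)%g \in F ->
  s p c = s q c -> p = q.
Proof.
move=> s1 gc pF qF p'F pqF epq; apply/eqP; rewrite eq_sym.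
have [//|pq] := eqVneq q p.
have/(sofic_at_free gc pqF)/eqP[] : (p^-1 * q != 1)%g.
  by rewrite -(inj_eq (mulgI p)) mulVKg mulg1.
by rewrite (sofic_atM gc) // -epq -(sofic_atM gc) // mulVg s1 perm1.
Qed.

Definition partition_at (G : groupType) (A : {pred G}) (C B : finType)
    (F : {fset G}) (s : G -> {perm C}) (tau : C -> B) (c : C) : bool :=
  sofic_at F s c && all (fun g => (tau (s g c) == tau c) == (g \in A)) F.

Section Carving.
Variables (G : groupType) (A : groupClosed G) (K : {fset subgroup A}).
Variables (C : finType) (s : G -> {perm C}).

Definition centers (c : C) : {set C} := [set s (val (val k))^-1%g c | k : K].

Lemma mem_centers k c : k \in K -> s (val k)^-1%g c \in centers c.
Proof. by move=> kK; apply/imsetP; exists [` kK]%fset. Qed.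

Definition translate (a : subgroup A) : {fset subgroup A} :=
  [fset (a * k)%g | k in K]%fset.

(** The order is a coordinate of the point, so that averaging over random orders becomes a
    density. *)
Definition carve (p : C * {perm C}) : option C := first_in (centers p.1) p.2.

Variables (F P F' : {fset G}) (c : C).
Hypotheses (s1 : s 1%g = 1%g) (gc : sofic_at F' s c).
Hypotheses (FP : {subset F <= P})
  (KP : {in K, forall k, (val k)^-1%g \in P})
  (KFP : {in K & F, forall k g, ((val k)^-1 * g)%g \in P})
  (PF' : {subset P <= F'})
  (PF'1 : {in P, forall p, p^-1%g \in F'})
  (PF'2 : {in P & P, forall p q, (p^-1 * q)%g \in F'}).

Let s_inj p q : p \in P -> q \in P -> s p c = s q c -> p = q.
Proof. by move=> pP qP; apply: (sofic_at_inj s1 gc); auto. Qed.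

Lemma card_centers : #|centers c| = #|` K|.
Proof.
rewrite card_imset ?cardfE // => k k' e.
by do 2!apply: val_inj; apply: invg_inj; apply: s_inj e; apply/KP/valP.
Qed.

(** A common first center gives k^-1 g = k'^-1 with k, k' in [K], so that g = k k'^-1 lies in [A].
    This holds for every order. *)
Lemma carve_neq w g :
  K != fset0%fset -> g \in F -> g \notin A -> carve (s g c, w) != carve (c, w).
Proof.
move=> /fset0Pn[k0 k0K] gF gA; rewrite /carve /=.
have [|x /imsetP[k _ ->] ->] := @first_in_ex _ (centers (s g c)) w.
  by apply/finset.set0Pn; exists (s (val k0)^-1%g (s g c)); exact: mem_centers.
apply/eqP => /esym/first_in_mem/imsetP[k' _].
rewrite -(sofic_atM gc); [|by apply/PF'/KP/valP|by apply/PF'/FP].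
move/s_inj => e; case/negP: gA.
have -> : g = val (val k * (val k')^-1)%g.
  rewrite -[LHS](mulVKg (val (val k)))  e //; first by apply: KFP => //; exact: valP.
  by apply/KP/valP.
exact: valP.
Qed.

(** Since k^-1 a = (a^-1 k)^-1, moving c by a replaces [K] by a^-1 [K] in the set of centers. *)
Lemma card_centers_diff (a : subgroup A) : val a \in F ->
  (#|(centers (s (val a) c) :\: centers c) :|: (centers c :\: centers (s (val a) c))|
   <= #|` ((translate a^-1%g `\` K) `|` (K `\` translate a^-1%g))%fset|)%N.
Proof.
move=> aF; set SD := (_ `|` _)%fset.
have sE k : k \in K -> s (val k)^-1%g (s (val a) c) = s (val (a^-1 * k)%g)^-1%g c.
  move=> kK; rewrite -(sofic_atM gc); [|by apply/PF'/KP|by apply/PF'/FP].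
  by rewrite -[in RHS]gmulfV /= invgM invgK.
rewrite cardfE; apply: (@leq_trans #|[set s (val (val k))^-1%g c | k : SD]|); last first.
  exact: leq_imset_card.
apply: subset_leq_card; apply/fintype.subsetP => x.
rewrite !inE => /orP[/andP[xN /imsetP[k _ xE]]|/andP[xN /imsetP[k _ xE]]].
  have kK := valP k; rewrite sE // in xE.
  have kSD : (a^-1 * val k)%g \in SD.
    rewrite !inE; apply/orP; left; apply/andP; split; last by apply/imfsetP; exists (val k).
    by apply: contra xN => ?; rewrite xE mem_centers.
  by apply/imsetP; exists [` kSD]%fset.
have kK := valP k.
have kSD : val k \in SD.
  rewrite !inE kK andbT; apply/orP; right; apply: contra xN => /imfsetP[k' /= k'K e].
  by rewrite xE [val k]e -sE // mem_centers.
by apply/imsetP; exists [` kSD]%fset.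
Qed.

(** In [first_in_neq_card] the union contains [centers c], which has as many elements as [K]. *)
Lemma density_carve (a : subgroup A) (e : R) :
  K != fset0%fset -> val a \in F ->
  #|` ((translate a^-1%g `\` K) `|` (K `\` translate a^-1%g))%fset|%:R <= e * #|` K|%:R ->
  density R [set w | carve (s (val a) c, w) != carve (c, w)] <= e.
Proof.
move=> K0 aF Ke.
have P0 : (0 < #|{perm C}|)%N by apply/card_gt0P; exists 1%g.
have K0R : 0 < #|` K|%:R :> R by rewrite ltr0n cardfs_gt0.
rewrite /density ler_pdivrMr ?ltr0n // -(ler_pM2r K0R) mulrAC.
apply: le_trans (ler_wpM2r (ler0n _ _) Ke); rewrite -!natrM ler_nat.
apply: leq_trans (leq_mul (card_centers_diff aF) (leqnn _)).
apply: leq_trans (first_in_neq_card _ _); rewrite leq_mul2l -card_centers.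
by rewrite subset_leq_card ?orbT // finset.subsetUr.
Qed.

End Carving.

Lemma sofic_amenable_partition (G : groupType) (A : groupClosed G)
    (F : {fset G}) (e : R) :
  sofic R G -> amenable R (subgroup A) -> 0 < e ->
  exists (C B : finType) (s : G -> {perm C}) (tau : C -> B),
    [/\ (0 < #|C|)%N, s 1%g = 1%g &
        density R [set c | ~~ partition_at A F s tau c] < e].
Proof.
move=> sG aA e0.
pose n := (#|` F|.+1)%N; pose e' := e / 2 / n%:R.
have e'0 : 0 < e' by rewrite !divr_gt0 ?ltr0n.
(* Inverses, because moving a point by a translates [K] by a^-1. *)
pose FA : {fset subgroup A} :=
  [fset (x^-1)%g | x in (pmap insub (enum_fset F) : seq (subgroup A))]%fset.
have [K K0 Kfol] := aA FA e' e'0.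
(* [P] holds the elements whose images of a point get compared; [F'] adds their quotients, so that
   these images are distinct at good points. *)
pose P : {fset G} := (F `|` [fset (val k)^-1%g | k in K] `|`
  [fset ((val k)^-1 * g)%g | k in K, g in F])%fset.
pose F' : {fset G} := (P `|` [fset p^-1%g | p in P] `|`
  [fset (p^-1 * q)%g | p in P, q in P])%fset.
have e20 : 0 < e / 2 by rewrite divr_gt0.
have [C [s [C0 s1 sP]]] := sofic_pointwise F' sG e20.
have FP : {subset F <= P} by move=> x xF; rewrite !inE xF.
have KP : {in K, forall k, (val k)^-1%g \in P}.
  by move=> k kK; rewrite !inE; apply/orP; left; apply/orP; right; apply/imfsetP; exists k.
have KFP : {in K & F, forall k g, ((val k)^-1 * g)%g \in P}.
  by move=> k g kK gF; rewrite !inE; apply/orP; right; apply/imfset2P;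
    exists k => //; exists g.
have PF' : {subset P <= F'} by move=> x xF; rewrite 2!inE xF.
have PF'1 : {in P, forall p, p^-1%g \in F'}.
  by move=> k kK; rewrite 2!inE; apply/orP; left; apply/orP; right; apply/imfsetP; exists k.
have PF'2 : {in P & P, forall p q, (p^-1 * q)%g \in F'}.
  by move=> k g kK gF; rewrite 2!inE; apply/orP; right; apply/imfset2P;
    exists k => //; exists g.
exists (C * {perm C})%type, (option C),
  (fun g : G => twist (s g) (fun=> 1%g : {perm {perm C}})), (carve K s).
split.
- by rewrite card_prod muln_gt0 C0; apply/card_gt0P; exists 1%g.
- by apply/permP => -[c w]; rewrite twistE s1 !perm1.
apply: (@le_lt_trans _ _ (density R [set c | ~~ sofic_at F' s c] + e' *+ #|` F|)).
  apply: density_fibre; first by rewrite mulrn_wge0 ?ltW.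
  move=> c; rewrite inE negbK => gc.
  apply: (@le_trans _ _ (density R [set w |
      has (fun g => (g \in A) && (carve K s (s g c, w) != carve K s (c, w))) F])).
    apply: densityS; apply/fintype.subsetP => w; rewrite !inE.
    apply: contraR => /hasPn H; apply/andP; split.
      apply/allP => g gF; have gF' := PF' _ (FP _ gF); apply/andP; split.
        apply/allP => h hF; have hF' := PF' _ (FP _ hF).
        by rewrite !twistE !perm1 (sofic_atM gc).
      have [//|g1 /=] := eqVneq g 1%g; rewrite twistE perm1.
      by apply: contra (sofic_at_free gc gF' g1) => /eqP[->].
    apply/allP => g gF; rewrite twistE perm1; have := H g gF.
    have [gA|gA _] := boolP (g \in A); first by rewrite /= negbK => ->.
    by rewrite (negPf (carve_neq s1 gc FP KP KFP PF' PF'1 PF'2 w K0 gF gA)).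
  apply: density_has => g gF.
  have [gA|gA] := boolP (g \in A); last first.
    by rewrite (_ : [set _ | _] = finset.set0) ?density0 ?ltW //.
  pose a : subgroup A := Sub g gA.
  rewrite -[g]/(val a).
  apply: (density_carve s1 gc FP KP PF' PF'1 PF'2 K0 (a := a) gF).
  apply/ltW/Kfol/imfsetP; exists a => //=.
  by rewrite mem_pmap; apply/mapP; exists g => //; rewrite (insubT (fun x => x \in A) gA).
have -> : e = e / 2 + e / 2 by lra.
rewrite ltrD // -[X in X < _]mulr_natr /e' -mulrA -[ltRHS]mulr1 ltr_pM2l //.
by rewrite mulrC ltr_pdivrMr ?ltr0n // mul1r ltr_nat.
Qed.

End Partition.

(** * Involutions without short relations *)

Section FreeInvolutions.

(* Words without equal consecutive letters are the vertices of a tree whose   *)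
(* edges are coloured by letters: [tree_step L y] crosses the edge coloured y *)
(* in the ball of radius L. Fixing the words starting with y y keeps this an  *)
(* involution on all words of length at most L.                               *)
Definition tree_step (Y : eqType) (L : nat) (y : Y) (w : seq Y) : seq Y :=
  if ohead w == Some y then
    if ohead (behead w) == Some y then w else behead w
  else if (size w < L)%N then y :: w else w.

Lemma tree_step_size (Y : eqType) L (y : Y) w :
  (size w <= L)%N -> (size (tree_step L y w) <= L)%N.
Proof.
rewrite /tree_step; case: ifP => _; case: ifP => // _ wL.
by rewrite size_behead (leq_trans (leq_pred _)).
Qed.

Lemma tree_stepK (Y : eqType) L (y : Y) w :
  (size w <= L)%N -> tree_step L y (tree_step L y w) = w.
Proof.
rewrite /tree_step => wL; case: (boolP (ohead w == Some y)) => [wy|/negPf wy].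
  case: (boolP (ohead (behead w) == Some y)) => [wyy|/negPf wyy].
    by rewrite wy wyy.
  by rewrite wyy; case: w wy wL {wyy} => //= z w /eqP[->] ->.
case: (ltnP (size w) L) => wL'; first by rewrite /= eqxx wy.
by rewrite wy ltnNge wL'.
Qed.

(** Read from the right, each letter of [w] is prepended: this is the path from the root to the
    vertex [w]. *)
Lemma tree_step_word (Y : eqType) L (w : seq Y) :
  (size w <= L)%N -> sorted (fun a b => a != b) w ->
  foldr (tree_step L) [::] w = w.
Proof.
elim: w => //= y w IH wL yw; rewrite IH ?(ltnW wL) ?(path_sorted yw) //.
rewrite /tree_step wL; case: ifP => //; case: w yw {IH wL} => //= z w.
by case/andP=> yz _ /eqP[zy]; rewrite zy eqxx in yz.
Qed.

Section Tree.
Variables (Y : finType) (L : nat).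

Definition tree_fun (y : Y) (v : L.-bseq Y) : L.-bseq Y :=
  Bseq (tree_step_size y (size_bseq v)).

Lemma tree_funK y : involutive (tree_fun y).
Proof. by move=> v; apply: val_inj; rewrite /= tree_stepK ?size_bseq. Qed.

Definition tree_perm y : {perm L.-bseq Y} := perm (inv_inj (tree_funK y)).

Lemma tree_perm2 y : (tree_perm y * tree_perm y = 1)%g.
Proof. by apply/permP => v; rewrite permM perm1 !permE tree_funK. Qed.

(* Acting by multiplication on the permutation group rather than on words, a  *)
(* product that is not the identity moves every point.                        *)
Definition tree_mul y : {perm {perm L.-bseq Y}} :=
  perm (can_inj (mulgK (tree_perm y))).

Lemma tree_mulK y : involutive (tree_mul y).
Proof. by move=> d; rewrite !permE -mulgA tree_perm2 mulg1. Qed.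

Lemma tree_mul_free (w : seq Y) d :
  w != [::] -> (size w <= L)%N -> sorted (fun a b => a != b) w ->
  foldr (fun y => tree_mul y) d w != d.
Proof.
move=> w0 wL ws; pose e : L.-bseq Y := [bseq].
(* At d^-1 e, the permutation d takes the root as its value, while the product applied to d takes
   the vertex [w]. *)
have fE u : val (foldr (fun y => tree_mul y) d u (d^-1%g e)) =
    foldr (tree_step L) [::] u.
  elim: u => [|y u IH] /=; first by rewrite permKV.
  by rewrite permE /= permM permE /= IH.
apply: contra w0 => /eqP H; have := fE w.
by rewrite H permKV tree_step_word // => <-.
Qed.

End Tree.

Lemma free_involutions (Z : choiceType) (r : seq Z) (L : nat) :
  exists (D : finType) (t : Z -> {perm D}),
    [/\ (0 < #|D|)%N, forall z, involutive (t z) &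
    forall w d, w != [::] -> (size w <= L)%N -> {subset w <= r} ->
      sorted (fun a b => a != b) w -> foldr (fun z => t z) d w != d].
Proof.
exists {perm L.-bseq (seq_sub r)},
  (fun z => if insub z is Some y then tree_mul L y else 1%g).
split=> [|z d|w d w0 wL wr ws]; first by apply/card_gt0P; exists 1%g.
  by case: insub => [y|]; rewrite ?tree_mulK // !perm1.
have [u wE] : exists u : seq (seq_sub r), w = map val u.
  elim: w wr {w0 wL ws} => [|z w IH] wr; first by exists [::].
  have [|u ->] := IH; first by move=> y yw; apply: wr; rewrite inE yw orbT.
  by exists (SeqSub (wr z (mem_head _ _)) :: u).
rewrite {}wE size_map in w0 wL ws *.
rewrite (_ : foldr _ _ _ = foldr (fun y => tree_mul L y) d u).
  apply: tree_mul_free => //; first by case: (u) w0.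
  by move: ws; rewrite sorted_map; apply: sub_sorted => a b; rewrite /= (inj_eq val_inj).
by elim: u {w0 wL ws wr} => //= y u ->; rewrite valK.
Qed.

End FreeInvolutions.

(** * Approximate actions of an amalgam *)

Section Countability.
Local Open Scope quotient_scope.

Lemma countable_setTP (T : Type) :
  countable [set: T]%classic <-> exists f : T -> nat, injective f.
Proof.
split=> [/countable_injP[f fi]|[f fi]].
  by exists f => x y; apply: fi; rewrite inE.
by apply/countable_injP; exists f => x y _ _; exact: fi.
Qed.

Lemma countable_pair (S T : Type) :
  countable [set: S]%classic -> countable [set: T]%classic ->
  countable [set: S * T]%classic.
Proof.
move=> /countable_setTP[f fi] /countable_setTP[g gi]; apply/countable_setTP.
exists (fun p => @choice.pickle (nat * nat)%type (f p.1, g p.2)) => -[a b] [c d].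
by move/(pcan_inj choice.pickleK) => [/fi -> /gi ->].
Qed.

Lemma countable_amalg (G : groupType) (A : groupClosed G) (X : choiceType) :
  countable [set: G]%classic -> countable [set: X]%classic ->
  countable [set: amalg A X]%classic.
Proof.
move=> /countable_setTP[f fi] /countable_setTP[g gi]; apply/countable_setTP.
pose code (l : amalg_letter A X) : nat + nat * nat :=
  match l with inl a => inl (f (val a)) | inr (x, h) => inr (g x, f h) end.
have codeI : injective code.
  move=> [a|[x h]] [b|[y k]] //=; first by case=> /fi/val_inj ->.
  by case=> /gi -> /fi ->.
exists (fun p => @choice.pickle (seq (nat + nat * nat)) (map code (repr p))) => p q.
move/(pcan_inj choice.pickleK)/(inj_map codeI)/(congr1 (\pi_(amalg A X))).
by rewrite !reprK.
Qed.

End Countability.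

Section Models.
Import Order.TTheory GRing.Theory Num.Theory.
Local Open Scope ring_scope.
Variables (R : realType) (G : groupType) (A : groupClosed G) (I : choiceType).

Record model := Model {
  points : finType;
  blocks : finType;
  sigma : G -> {perm points};
  block : points -> blocks;
  points_gt0 : (0 < #|points|)%N;
  sigma1 : sigma 1%g = 1%g }.

Implicit Types (m : model) (P Q : model -> Prop) (F : {fset G}).
Implicit Types (u v : seq (amalg_letter A I)).

Definition model_at m F : pred (points m) := partition_at A F (sigma m) (@block m).
Arguments model_at : clear implicits.

(* P holds for all sufficiently good partitioned approximations. *)
Definition eventually P : Prop :=
  exists F (e : R), 0 < e /\
    forall m, density R [set c | ~~ model_at m F c] < e -> P m.

Lemma eventually_mono P Q :
  (forall m, P m -> Q m) -> eventually P -> eventually Q.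
Proof. by move=> PQ [F [e [e0 eP]]]; exists F, e; split=> // m /eP/PQ. Qed.

Lemma partition_at_sub F F' m (c : points m) :
  {subset F <= F'} -> model_at m F' c -> model_at m F c.
Proof.
move=> sF /andP[/allP H1 /allP H2]; apply/andP; split; apply/allP => g /sF gF.
  have /andP[/allP H3 ->] := H1 _ gF; rewrite andbT.
  by apply/allP => h /sF; exact: H3.
exact: H2.
Qed.

Lemma eventually_and P Q :
  eventually P -> eventually Q -> eventually (fun m => P m /\ Q m).
Proof.
move=> [F [e [e0 eP]]] [F' [e' [e'0 eQ]]].
exists (F `|` F')%fset, (Num.min e e'); split; first by rewrite lt_min e0.
move=> m; rewrite lt_min => /andP[me me']; split; [apply: eP|apply: eQ].
  apply: le_lt_trans me; apply: densityS; apply/fintype.subsetP => c.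
  rewrite !inE; apply: contra; apply: partition_at_sub => g gF.
  by rewrite inE gF.
apply: le_lt_trans me'; apply: densityS; apply/fintype.subsetP => c.
rewrite !inE; apply: contra; apply: partition_at_sub => g gF.
by rewrite inE gF orbT.
Qed.

Lemma eventually_all (T : eqType) (r : seq T) (P : T -> model -> Prop) :
  {in r, forall x, eventually (P x)} ->
  eventually (fun m => {in r, forall x, P x m}).
Proof.
elim: r => [|x r IH] H; first by exists fset0, 1; split.
have := eventually_and (H x (mem_head _ _)) (IH _).
move=> /(_ _)/eventually_mono; apply; last first.
  by move=> y yr; apply: H; rewrite inE yr orbT.
by move=> m [Px Pr] y; rewrite inE => /orP[/eqP ->|/Pr].
Qed.

Lemma eventually_density F (e : R) :
  0 < e -> eventually (fun m => density R [set c | ~~ model_at m F c] < e).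
Proof. by move=> e0; exists F, e; split. Qed.

Lemma eventually_ex P :
  sofic R G -> amenable R (subgroup A) -> eventually P -> exists m, P m.
Proof.
move=> sG aA [F [e [e0 eP]]].
have [C [B [s [tau [C0 s1 H]]]]] := sofic_amenable_partition F sG aA e0.
by exists (Model tau C0 s1); apply: eP.
Qed.

Section WordPerm.
Variables (m : model) (D : finType) (t : I * blocks m -> {perm D}).

(* For inr (x, g), this is the conjugate of [sigma m g] acting on points by   *)
(* the map (c, d) |-> (c, t (x, block c) d).                                  *)
Definition letter_perm (l : amalg_letter A I) : {perm points m * D} :=
  match l with
  | inl a => twist (sigma m (val a)) (fun=> 1%g)
  | inr (x, g) => twist (sigma m g)
      (fun c => ((t (x, block c))^-1 * t (x, block (sigma m g c)))%g)
  end.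

(** The factors are reversed because [p * q] applies p first; the last letter of the word acts
    first. *)
Definition word_perm u : {perm points m * D} :=
  foldr (fun l p => (p * letter_perm l)%g) 1%g u.

Lemma word_perm_cat u v : word_perm (u ++ v) = (word_perm v * word_perm u)%g.
Proof. by elim: u => [|l u IH] /=; rewrite ?mulg1 // IH mulgA. Qed.

Lemma hamming_pointwise (b : {set points m}) (p q : {perm points m * D}) :
  (forall c d, c \notin b -> p (c, d) = q (c, d)) ->
  hamming R p q <= density R b.
Proof.
move=> H; rewrite -[leRHS]addr0; apply: density_fibre => // c cb.
rewrite (_ : [set _ | _] = finset.set0) ?density0 //.
by apply/finset.setP => d; rewrite !inE H // eqxx.
Qed.

End WordPerm.

Lemma eventually_word_pointwise F u v (e : R) : 0 < e ->
  (forall m D (t : I * blocks m -> {perm D}) c d, model_at m F c ->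
     word_perm t u (c, d) = word_perm t v (c, d)) ->
  eventually (fun m => forall D (t : I * blocks m -> {perm D}),
    hamming R (word_perm t u) (word_perm t v) < e).
Proof.
move=> e0 H; apply: eventually_mono (eventually_density F e0) => m me D t.
apply: le_lt_trans me; apply: hamming_pointwise => c d.
by rewrite inE negbK; exact: H.
Qed.

(** Induction on the derivation: the Hamming distance is bi-invariant, so errors add under
    transitivity and concatenation. The bound is uniform in [D] and [t], which can only be chosen
    once the blocks of the model are known. *)
Lemma eventually_cong u v (e : R) : amalg_cong u v -> 0 < e ->
  eventually (fun m => forall D (t : I * blocks m -> {perm D}),
    hamming R (word_perm t u) (word_perm t v) < e).
Proof.
move=> uv; elim: uv e => {u v} [u|u v _ IH|v u w _ IHl _ IHr|
    u u' v v' _ IHl _ IHr||a b|x|x g h|x a] e e0.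
- exact: (@eventually_word_pointwise fset0).
- by apply: eventually_mono (IH e e0) => m H D t; rewrite hamming_sym.
- have e20 : 0 < e / 2 by lra.
  apply: eventually_mono (eventually_and (IHl _ e20) (IHr _ e20)) => m [H H'] D t.
  apply: le_lt_trans (hamming_triangle R (word_perm t v) _ _) _.
  by have := H D t; have := H' D t; lra.
- have e20 : 0 < e / 2 by lra.
  apply: eventually_mono (eventually_and (IHl _ e20) (IHr _ e20)) => m [H H'] D t.
  rewrite !word_perm_cat.
  apply: le_lt_trans (hamming_triangle R (word_perm t v' * word_perm t u)%g _ _) _.
  rewrite hamming_mulr hamming_mull.
  by have := H D t; have := H' D t; lra.
- apply: (@eventually_word_pointwise fset0) => // m D t c d _.
  by rewrite /= mul1g twistE /= sigma1 !perm1.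
- apply: (@eventually_word_pointwise [fset val a; val b]%fset) => // m D t c d.
  case/andP=> /sofic_atM H _; rewrite /= !mul1g permM !twistE !perm1.
  by rewrite -H ?inE ?eqxx ?orbT.
- apply: (@eventually_word_pointwise fset0) => // m D t c d _.
  by rewrite /= mul1g twistE /= sigma1 !perm1 mulVg perm1.
- apply: (@eventually_word_pointwise [fset g; h]%fset) => // m D t c d.
  case/andP=> /sofic_atM H _; rewrite /= !mul1g permM !twistE.
  by rewrite -H ?inE ?eqxx ?orbT // !permM permK.
(* An element of [A] keeps c in its block, so the two factors [t] of the conjugation cancel. *)
- apply: (@eventually_word_pointwise [fset val a]%fset) => // m D t c d.
  case/andP=> _ /allP /(_ (val a)); rewrite !inE eqxx => /(_ isT).
  have aA : val a \in A by exact: valP.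
  rewrite aA eqb_id => /eqP H.
  by rewrite /= !mul1g !twistE H mulVg.
Qed.

Definition reduced (w : seq (I * G)) : bool :=
  all (fun l => l.2 \notin A) w && sorted (fun l l' => l.1 != l'.1) w.

Definition copies (w : seq (I * G)) : seq (amalg_letter A I) := map inr w.

Section Path.
Variable m : model.

Definition path_perm (w : seq (I * G)) : {perm points m} :=
  foldr (fun l p => (p * sigma m l.2)%g) 1%g w.

(* The letters of the word in t that [copies w] applies to d over c, when the *)
(* t z are involutions (see [word_perm_copies]).                              *)
Fixpoint labels (w : seq (I * G)) (c : points m) : seq (I * blocks m) :=
  if w is l :: w' then
    [:: (l.1, block (path_perm w c)), (l.1, block (path_perm w' c)) & labels w' c]
  else [::].

Fixpoint separated (w : seq (I * G)) (c : points m) : bool :=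
  if w is l :: w' then
    (block (path_perm w c) != block (path_perm w' c)) && separated w' c
  else true.

(** The two labels of one letter differ in the block, by separation; adjacent labels of consecutive
    letters differ in the index, by reducedness. *)
Lemma labels_sorted w c :
  reduced w -> separated w c -> sorted (fun a b => a != b) (labels w c).
Proof.
rewrite /reduced; elim: w => // -[x g] w IH /andP[/= /andP[_ wA] xw].
case/andP=> sep sepw; rewrite xpair_eqE eqxx /= sep /=.
have {}IH := IH; rewrite wA (path_sorted xw) sepw in IH.
case: w xw {sep sepw wA} IH => //= -[y h] w /andP[xy _] /(_ isT isT) /= ->.
by rewrite xpair_eqE negb_and xy.
Qed.

Lemma size_labels w c : size (labels w c) = (size w).*2.
Proof. by elim: w => //= l w ->. Qed.

Lemma labels_index w c : {subset map fst (labels w c) <= map fst w}.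
Proof.
elim: w => //= l w IH x; rewrite !inE => /or3P[->|->|/IH ->] //.
by rewrite orbT.
Qed.

Lemma word_perm_copies D (t : I * blocks m -> {perm D}) w c d :
  (forall z, involutive (t z)) ->
  word_perm t (copies w) (c, d) =
    (path_perm w c, foldr (fun z => t z) d (labels w c)).
Proof.
move=> tK; elim: w => [|[x g] w IH] /=; first by rewrite !perm1.
rewrite permM IH twistE !permM; congr (_, t _ _).
by apply: (canLR (permK _)); rewrite tK.
Qed.

End Path.

(** A letter outside [A] changes the block at good points, and [path_perm] preserves the density of
    the bad ones. *)
Lemma eventually_separated w (e : R) : 0 < e -> reduced w ->
  eventually (fun m => density R [set c : points m | ~~ separated w c] < e).
Proof.
move=> e0 /andP[wA _]; elim: w wA e e0 => [|[x g] w IH] /= wA e e0.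
  exists fset0, 1; split=> // m _.
  by rewrite (_ : [set _ | _] = finset.set0) ?density0.
have e20 : 0 < e / 2 by lra.
case/andP: wA => gA wA.
apply: eventually_mono (eventually_and (IH wA _ e20)
  (eventually_density [fset g]%fset e20)) => m [H1 H2].
rewrite -(density_preim _ (path_perm m w)) in H2.
apply: (@le_lt_trans _ _ (_ + _)); last first.
  by rewrite (_ : e = e / 2 + e / 2); [exact: ltrD H2 H1|lra].
apply: le_trans (densityU _ _ _); apply: densityS; apply/fintype.subsetP => c.
rewrite !inE negb_and => /orP[Hc|->]; last by rewrite orbT.
apply/orP; left; apply: contra Hc => /andP[_ /allP/(_ g)].
by rewrite inE eqxx (negPf gA) => /(_ isT) /eqP; rewrite permM => ->.
Qed.

Definition word_index u : seq I := pmap (fun l => if l is inr p then Some p.1 else None) u.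

Lemma word_index_copies w : word_index (copies w) = map fst w.
Proof. by elim: w => //= l w ->. Qed.

Definition free_system m (L : nat) (xs : seq I) (D : finType)
    (t : I * blocks m -> {perm D}) : Prop :=
  (forall z, involutive (t z)) /\
  forall w d, w != [::] -> (size w <= L)%N -> {subset map fst w <= xs} ->
    sorted (fun a b => a != b) w -> foldr (fun z => t z) d w != d.

Lemma free_system_ex m L xs :
  exists (D : finType) (t : I * blocks m -> {perm D}),
    (0 < #|D|)%N /\ free_system L xs t.
Proof.
have [D [t [D0 tK tF]]] :=
  free_involutions [seq (x, b) | x <- xs, b <- enum (blocks m)] L.
exists D, t; split=> //; split=> // w d w0 wL wxs; apply: tF => // -[x b] xbw.
apply/allpairsP; exists (x, b); split=> //=; last by rewrite mem_enum.
by apply: wxs; apply/mapP; exists (x, b).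
Qed.

Definition normal_word u : Prop :=
  (exists2 a, a != 1%g & u = [:: inl a]) \/
  (exists w, [/\ w != [::], reduced w & u = copies w]).

(** A nontrivial element of [A] moves the coordinate in [points m]. Over a separated point, a
    reduced word moves the coordinate in [D], by a word of labels twice as long. *)
Lemma eventually_moves u (e : R) : 0 < e -> normal_word u ->
  eventually (fun m => forall L xs D (t : I * blocks m -> {perm D}),
    free_system L xs t -> ((size u).*2 <= L)%N -> {subset word_index u <= xs} ->
    density R [set p | word_perm t u p == p] < e).
Proof.
move=> e0 [[a a1 ->]|[w [w0 wr ->]]].
  apply: eventually_mono (eventually_density [fset val a]%fset e0) => m H L xs D t _ _ _.
  apply: le_lt_trans H; rewrite -[leRHS]addr0; apply: density_fibre => // c.
  rewrite inE negbK => /andP[/sofic_at_free H _].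
  rewrite (_ : [set _ | _] = finset.set0) ?density0 //; apply/finset.setP => d.
  rewrite !inE /= mul1g twistE; apply/negbTE; rewrite xpair_eqE negb_and H //.
    by rewrite inE.
apply: eventually_mono (eventually_separated e0 wr) => m H L xs D t [tK tF] wL wxs.
apply: le_lt_trans H; rewrite -[leRHS]addr0; apply: density_fibre => // c.
rewrite inE negbK => sep.
rewrite (_ : [set _ | _] = finset.set0) ?density0 //; apply/finset.setP => d.
rewrite !inE word_perm_copies //; apply/negbTE; rewrite xpair_eqE negb_and orbC tF //.
- by case: (w) w0.
- by rewrite size_labels; move: wL; rewrite size_map.
- by move=> x /labels_index; rewrite -word_index_copies; exact: wxs.
- exact: labels_sorted.
Qed.

End Models.

(** * Normal forms and soficity *)

Section NormalForm.
Variables (G : groupType) (A : groupClosed G) (I : choiceType).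
Implicit Types (u v : seq (amalg_letter A I)) (w : seq (I * G)).

Lemma amalg_cons l u v : amalg_cong u v -> amalg_cong (l :: u) (l :: v).
Proof. by move=> uv; apply: (@amalg_cat _ _ _ [:: l] [:: l]) => //; exact: amalg_refl. Qed.

Lemma amalg_merge (l l' k : amalg_letter A I) u v :
  amalg_cong u (l' :: v) -> amalg_cong [:: l; l'] [:: k] ->
  amalg_cong (l :: u) (k :: v).
Proof.
move=> /(amalg_cons l) lu ll; apply: amalg_trans lu _.
by apply: (@amalg_cat _ _ _ [:: l; l'] [:: k]) => //; exact: amalg_refl.
Qed.

Lemma reduced_head x g h w :
  (g \in A) = (h \in A) -> reduced A ((x, g) :: w) = reduced A ((x, h) :: w).
Proof. by rewrite /reduced /= => ->; case: w. Qed.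

Definition normalizes u : Prop :=
  (exists a, amalg_cong u [:: inl a]) \/
  (exists w, [/\ w != [::], reduced A w & amalg_cong u (copies A w)]).

Lemma normalizes_cong u v : amalg_cong u v -> normalizes v -> normalizes u.
Proof.
move=> uv [[a va]|[w [w0 wr vw]]]; first by left; exists a; exact: amalg_trans va.
by right; exists w; split=> //; exact: amalg_trans vw.
Qed.

Lemma normalizes_base b u : normalizes u -> normalizes (inl b :: u).
Proof.
move=> [[a ua]|[[|[x g] w] [// _ wr uw]]].
  left; exists (b * a)%g; apply: amalg_merge ua _; exact: amalg_baseM.
right; exists ((x, val b * g)%g :: w); split=> //.
  by rewrite (reduced_head _ _ (gpredMl _ (valP b))).
apply: amalg_merge uw _; apply: amalg_trans (amalg_copyM _ _ _ _).
apply: (@amalg_cat _ _ _ [:: inl b] [:: inr (x, val b)]); last exact: amalg_refl.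
exact: amalg_glue.
Qed.

Lemma normalizes_copies w : reduced A w -> normalizes (copies A w).
Proof.
case: w => [|l w] wr; last by right; exists (l :: w); split=> //; exact: amalg_refl.
by left; exists 1%g; apply: amalg_sym; exact: amalg_base1.
Qed.

Lemma normalizes_in x g u : g \in A -> normalizes u -> normalizes (inr (x, g) :: u).
Proof.
move=> gA; pose a : subgroup A := Sub g gA.
move/(normalizes_base a); apply: normalizes_cong.
apply: (@amalg_cat _ _ _ [:: inr (x, val a)] [:: inl a]); last exact: amalg_refl.
exact/amalg_sym/amalg_glue.
Qed.

(** A head in the same copy merges with g; if the product falls into [A], it is absorbed by the
    tail, which is still reduced. *)
Lemma normalizes_copy x g u : normalizes u -> normalizes (inr (x, g) :: u).
Proof.
have [gA|gA] := boolP (g \in A); first exact: normalizes_in.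
move=> [[a ua]|[[|[y h] w] [// _ wr uw]]].
  right; exists [:: (x, (g * val a)%g)]; split=> //.
    by rewrite /reduced /= gpredMr ?gA //; exact: valP.
  apply: amalg_merge ua _; apply: amalg_trans (amalg_copyM _ _ _ _).
  by apply: amalg_cons; exact: amalg_glue.
have [xy|xy] := eqVneq x y; last first.
  right; exists [:: (x, g), (y, h) & w]; split=> //; last exact: amalg_cons.
  by move: wr; rewrite /reduced /= gA xy.
subst y; have uw' : amalg_cong (inr (x, g) :: u) (inr (x, (g * h)%g) :: copies A w).
  by apply: amalg_merge uw _; exact: amalg_copyM.
apply: normalizes_cong uw' _.
have wr' : reduced A w.
  by move: wr => /andP[/= /andP[_ wA] /path_sorted ws]; rewrite /reduced wA.
have [ghA|ghA] := boolP (g * h \in A)%g.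
  by apply: normalizes_in => //; exact: normalizes_copies.
right; exists ((x, g * h)%g :: w); split=> //; last exact: amalg_refl.
by rewrite (@reduced_head _ _ h) // (negPf ghA); case/andP: wr => /= /andP[/negPf].
Qed.

Lemma normalizes_word u : normalizes u.
Proof.
elim: u => [|[a|[x g]] u IH]; last exact: normalizes_copy.
  by left; exists 1%g; apply: amalg_sym; exact: amalg_base1.
exact: normalizes_base.
Qed.

Local Open Scope quotient_scope.

Lemma normal_word_ex (p : amalg A I) : p != 1%g ->
  exists2 u, \pi_(amalg A I) u = p & normal_word u.
Proof.
rewrite -[p]reprK => p1; have [[a ra]|[w [w0 wr rw]]] := normalizes_word (repr p).
  exists [:: inl a]; first by apply/amalg_piP; exact: amalg_sym.
  left; exists a => //; apply: contra p1 => /eqP a1; apply/eqP/amalg_piP.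
  by apply: amalg_trans ra _; rewrite a1; exact: amalg_base1.
exists (copies A w); first by apply/amalg_piP; exact: amalg_sym.
by right; exists w.
Qed.

End NormalForm.

Section SoficAmalgam.
Import Order.TTheory GRing.Theory Num.Theory.
Local Open Scope ring_scope.
Local Open Scope quotient_scope.
Variable R : realType.

Lemma sofic_amalg (G : groupType) (A : groupClosed G) (I : choiceType) :
  sofic R G -> amenable R (subgroup A) -> countable [set: I]%classic ->
  sofic R (amalg A I).
Proof.
move=> sG aA cI; split; first exact: countable_amalg sG.1 cI.
move=> F e e0.
(* Representing 1 by the empty word makes the approximation exactly unital. *)
have repE (p : amalg A I) : exists u, \pi_(amalg A I) u = p /\
    (p = 1%g -> u = [::]) /\ (p != 1%g -> normal_word u).
  have [->|p1] := eqVneq p 1%g; first by exists [::].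
  have [u up un] := normal_word_ex p1; exists u; split=> //; split=> // pE.
  by rewrite pE eqxx in p1.
have [rep repP] := choice repE.
pose mult p m := {in F, forall q,
  forall D (t : I * blocks m -> {perm D}),
    hamming R (word_perm t (rep (p * q)%g)) (word_perm t (rep p ++ rep q)) < e}.
pose move p m := p != 1%g ->
  forall L xs D (t : I * blocks m -> {perm D}),
    free_system L xs t -> ((size (rep p)).*2 <= L)%N ->
    {subset word_index (rep p) <= xs} ->
    density R [set c | word_perm t (rep p) c == c] < e.
have [m Hm] : exists m, {in F, forall p, @mult p m /\ @move p m}.
  apply: (eventually_ex (A := A) sG aA).
  apply: eventually_all => p pF; apply: eventually_and.
    apply: eventually_all.
    move=> q qF; apply: eventually_cong => //; apply/amalg_piP.
    rewrite (repP _).1 -[LHS]/(amalg_mul p q); apply/amalg_piP.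
    by apply: amalg_cat; apply/amalg_piP; rewrite reprK (repP _).1.
  have [->|p1] := eqVneq p 1%g.
    by exists fset0, 1; split=> // m _; rewrite /move eqxx.
  by apply: eventually_mono (eventually_moves e0 ((repP p).2.2 p1)) => m H _.
pose xs := flatten [seq word_index (rep p) | p <- F].
pose L := \max_(p <- F) (size (rep p)).*2.
have [D [t [D0 tF]]] := free_system_ex m L xs.
have C0 : (0 < #|{: points m * D}|)%N by rewrite card_prod muln_gt0 points_gt0.
exists (points m * D)%type, (fun p => word_perm t (rep p)); split=> //.
- by rewrite /unital (repP _).2.1.
- move=> p q pF qF; rewrite -word_perm_cat; exact: (Hm p pF).1.
move=> p pF p1; rewrite hamming1E // ltrD2l ltrN2.
apply: (Hm p pF).2 tF _ _ => //.
  by rewrite /L (big_rem p) //= leq_maxl.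
by move=> x xp; apply/flattenP; exists (word_index (rep p)) => //; apply: map_f.
Qed.

End SoficAmalgam.

(** * Functoriality of the amalgam in its index set *)

Section Relabelling.
Local Open Scope quotient_scope.
Variables (G : groupType) (A : groupClosed G).

Definition relabel (X Y : choiceType) (f : X -> Y) (l : amalg_letter A X) :
    amalg_letter A Y :=
  match l with inl a => inl a | inr (x, g) => inr (f x, g) end.

Lemma relabel_cong (X Y : choiceType) (f : X -> Y) u v :
  amalg_cong u v -> amalg_cong (map (relabel f) u) (map (relabel f) v).
Proof.
elim=> {u v} [u|u v _|u v w _ uv _ vw|u u' v v' _ uu' _ vv'||a b|x|x g g'|x a] /=.
- exact: amalg_refl.
- exact: amalg_sym.
- exact: amalg_trans vw.
- by rewrite !map_cat; exact: amalg_cat.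
- exact: amalg_base1.
- exact: amalg_baseM.
- exact: amalg_copy1.
- exact: amalg_copyM.
- exact: amalg_glue.
Qed.

Definition amalg_map (X Y : choiceType) (f : X -> Y) (p : amalg A X) : amalg A Y :=
  \pi_(amalg A Y) (map (relabel f) (repr p)).

Lemma amalg_map_pi (X Y : choiceType) (f : X -> Y) u :
  amalg_map f (\pi_(amalg A X) u) = \pi_(amalg A Y) (map (relabel f) u).
Proof. by apply/amalg_piP/relabel_cong; exact: amalg_reprK. Qed.

Lemma amalg_map1 (X Y : choiceType) (f : X -> Y) : amalg_map f 1%g = 1%g.
Proof. by rewrite -[1%g in LHS]/(\pi_(amalg A X) [::]) amalg_map_pi. Qed.

Lemma amalg_mapM (X Y : choiceType) (f : X -> Y) :
  {morph amalg_map f : p q / (p * q)%g}.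
Proof.
move=> p q; apply/amalg_piP.
apply: amalg_trans (relabel_cong _ (amalg_reprK _)) _; rewrite map_cat.
by apply: amalg_sym; apply: amalg_cat; exact: amalg_reprK.
Qed.

Lemma amalg_map_copy (H : groupType) (X Y : choiceType) (alpha : laction H X)
    (f f' : X -> Y) h (p : amalg A X) :
  {in word_index (repr p), forall x, f' (alpha h x) = f x} ->
  amalg_map f' (copy_action A alpha h p) = amalg_map f p.
Proof.
move=> ff'; rewrite -[copy_action _ _ _ _]/(copy_map _ _ _) /copy_map amalg_map_pi.
rewrite -map_comp; congr (\pi_(amalg A Y) _).
elim: (repr p) ff' => // -[a|[x g]] u IH ff' /=; first by rewrite IH.
by rewrite ff' ?mem_head // IH // => y yu; apply: ff'; rewrite inE yu orbT.
Qed.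

(** The homomorphism to [G] that identifies all copies; it is injective on [A]. *)
Definition fold_word (X : choiceType) (u : seq (amalg_letter A X)) : G :=
  foldr (fun l g => (match l with inl a => val a | inr p => p.2 end * g)%g) 1%g u.

Lemma fold_word_cat (X : choiceType) (u v : seq (amalg_letter A X)) :
  fold_word (u ++ v) = (fold_word u * fold_word v)%g.
Proof. by elim: u => [|l u IH] /=; rewrite ?mul1g // IH mulgA. Qed.

Lemma fold_word_cong (X : choiceType) (u v : seq (amalg_letter A X)) :
  amalg_cong u v -> fold_word u = fold_word v.
Proof.
elim=> {u v} [||u v w _ -> _ ->|u u' v v' _ uu' _ vv'||a b|x|x g h|x a] //=.
- by rewrite !fold_word_cat uu' vv'.
- by rewrite mulg1.
- by rewrite !mulg1.
- by rewrite mulg1.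
- by rewrite !mulg1.
Qed.

Lemma relabelK (X Y : choiceType) (f : X -> Y) (g : Y -> X) u :
  {in word_index u, cancel f g} -> map (relabel g) (map (relabel f) u) = u.
Proof.
elim: u => // -[a|[x k]] u IH fK /=; first by rewrite IH.
by rewrite fK ?mem_head // IH // => y yu; apply: fK; rewrite inE yu orbT.
Qed.

Lemma word_index_nil (X : choiceType) (u : seq (amalg_letter A X)) :
  word_index u = [::] -> exists a, amalg_cong u [:: inl a].
Proof.
elim: u => [_|[a|//] u IH /= /IH[b ub]].
  by exists 1%g; apply: amalg_sym; exact: amalg_base1.
by exists (a * b)%g; apply: amalg_merge ub _; exact: amalg_baseM.
Qed.

(** An inverse of [f] on the indices of the word carries triviality over [Y] back to [X]. *)
Lemma amalg_map_eq1 (X Y : choiceType) (f : X -> Y) (p : amalg A X) :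
  {in word_index (repr p) &, injective f} -> amalg_map f p = 1%g -> p = 1%g.
Proof.
move=> fi /amalg_piP fp; rewrite -[p]reprK; apply/amalg_piP.
(* The inverse needs a default value [x0]. Without any index the word is an element of [A], detected
   by [fold_word]. *)
case E: (word_index (repr p)) => [|x0 ws]; last first.
  pose xs := word_index (repr p).
  pose g y := nth x0 xs (index y (map f xs)).
  have gK : {in xs, cancel f g}.
    move=> x xxs; have ix : (index (f x) (map f xs) < size xs)%N.
      by rewrite -(size_map f) index_mem map_f.
    apply: fi => //; first exact: mem_nth.
    by rewrite -(nth_map _ (f x0)) // nth_index // map_f.
  by have := relabel_cong g fp; rewrite relabelK.
have [a ua] := word_index_nil E.
have /fold_word_cong /= := amalg_trans (amalg_sym (relabel_cong f ua)) fp.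
rewrite mulg1 => a1; apply: amalg_trans ua _.
have -> : a = 1%g by exact: val_inj.
exact: amalg_base1.
Qed.

End Relabelling.

(** * Finite models of the wreath product *)

Section Wreath.
Import Order.TTheory GRing.Theory Num.Theory.
Local Open Scope ring_scope.
Local Open Scope quotient_scope.
Variable R : realType.

Lemma density_fst (C D : finType) (A : {set C}) :
  density R [set p : C * D | p.1 \in A] <= density R A.
Proof.
rewrite -[leRHS]addr0; apply: density_fibre => // c cA.
rewrite (_ : [set _ | _] = finset.set0) ?density0 //.
by apply/finset.setP => d; rewrite !inE (negPf cA).
Qed.

Lemma density_snd (C D : finType) (A : {set D}) :
  density R [set p : C * D | p.2 \in A] <= density R A.
Proof.
rewrite -[leRHS]add0r -(density0 R C); apply: density_fibre => [|c _].
  exact: density_ge0.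
by apply: densityS; apply/fintype.subsetP => d; rewrite !inE.
Qed.

Section WreathPerm.
Variables (G H : groupType) (A : groupClosed G) (X B : choiceType).
Variable alpha : laction H X.
Variables (C1 C2 D : finType) (phi : H -> {perm C1}) (s : H -> {perm C2}).
Variables (pi_ : C1 -> X -> B) (psi : amalg A B -> {perm D}).

(** The factor [C2] carries a sofic approximation of [H], which moves points under a nontrivial
    H-part. The embedding is taken at the image point, since (n, h) applies h before n. *)
Definition wreath_perm (p : amalgamated_wreath A alpha) : {perm C1 * C2 * D} :=
  twist (twist (phi p.2) (fun=> s p.2))
        (fun c => psi (amalg_map (pi_ (phi p.2 c.1)) p.1)).

Lemma wreath_permE p c1 c2 d : wreath_perm p (c1, c2, d) =
  (phi p.2 c1, s p.2 c2, psi (amalg_map (pi_ (phi p.2 c1)) p.1) d).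
Proof. by rewrite !twistE. Qed.

Lemma wreath_permM (F : {fset H}) (E : {fset X}) (FN : {fset amalg A B})
    (S : {set C1}) (p q : amalgamated_wreath A alpha) c1 c2 d :
  (forall c g x, c \in S -> g \in F -> x \in E -> phi g c \in S ->
     alpha g^-1%g x \in E -> pi_ (phi g c) x = pi_ c (alpha g^-1%g x)) ->
  p.2 \in F -> q.2 \in F ->
  {subset word_index (repr q.1) <= E} ->
  {in word_index (repr q.1), forall x, alpha p.2 x \in E} ->
  (forall c, amalg_map (pi_ c) p.1 \in FN) ->
  (forall c, amalg_map (pi_ c) q.1 \in FN) ->
  phi (p.2 * q.2)%g c1 = phi p.2 (phi q.2 c1) ->
  phi q.2 c1 \in S -> phi p.2 (phi q.2 c1) \in S ->
  sofic_at F s c2 -> sofic_at FN psi d ->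
  wreath_perm (p * q)%g (c1, c2, d) = wreath_perm p (wreath_perm q (c1, c2, d)).
Proof.
move=> orb pF qF qE pqE pN qN phiM S1 S2 sc psd.
rewrite !wreath_permE /= phiM (sofic_atM sc) //; congr (_, _, _).
rewrite -(sofic_atM psd) // amalg_mapM; congr (psi (_ * _)%g _).
apply: amalg_map_copy => x xq.
(* The orbit condition is used for [p.2] at the point [phi q.2 c1] and the index [alpha p.2 x]. *)
by rewrite orb ?pqE ?qE // -lactM mulVg lact1 ?qE.
Qed.

End WreathPerm.

Lemma sofic_wreath (G H : groupType) (A : groupClosed G) (X : choiceType)
    (alpha : laction H X) :
  countable [set: G]%classic -> sofic R H -> sofic_action R alpha ->
  (forall I : choiceType, countable [set: I]%classic -> sofic R (amalg A I)) ->
  sofic R (amalgamated_wreath A alpha).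
Proof.
move=> cG sH [cH cX sact] sN; split.
  exact: countable_pair (countable_amalg A cG cX) cH.
(* Multiplicativity has five exceptional sets of density at most e/6: three in [C1], one in [C2],
   one in the fibres [D]. *)
move=> F e e0; have e60 : 0 < e / 6 by lra.
pose FH : {fset H} := [fset p.2 | p in F]%fset.
pose supp (p : amalgamated_wreath A alpha) := word_index (repr (p.1 : amalg A X)).
pose E : {fset X} := [fset x in flatten
  [seq supp p ++ flatten [seq map (alpha q.2) (supp p) | q <- F] | p <- F]]%fset.
have FHP p : p \in F -> p.2 \in FH by move=> pF; apply/imfsetP; exists p.
have suppE p : p \in F -> {subset supp p <= E}.
  move=> pF x xp; rewrite inE; apply/flattenP => /=.
  by eexists; first exact: (map_f _ pF); rewrite mem_cat xp.
have suppaE p q : p \in F -> q \in F -> {in supp q, forall x, alpha p.2 x \in E}.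
  move=> pF qF x xp; rewrite inE; apply/flattenP => /=.
  eexists; first exact: (map_f _ qF); rewrite mem_cat; apply/orP; right.
  by apply/flattenP; eexists; [exact: (map_f _ pF)|exact: map_f].
have [C2 [s [C20 s1 sP]]] := sofic_pointwise FH sH e60.
have [C1 [phi [C10 phi1 phiM [B [S [pi_ [Scard pi_inj orb]]]]]]] := sact FH E _ e60.
have cB : countable [set: B]%classic.
  by apply/countable_setTP; exists choice.pickle; exact: (pcan_inj choice.pickleK).
(* Finite because [C1] is, and available once the embeddings [pi_] are fixed, before [psi] is
   chosen. *)
pose FN : {fset amalg A B} :=
  [fset amalg_map (pi_ c) (p.1 : amalg A X) | c in enum C1, p in enum_fset F]%fset.
have FNP c p : p \in F -> amalg_map (pi_ c) (p.1 : amalg A X) \in FN.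
  by move=> pF; apply/imfset2P; exists c; [rewrite /= mem_enum|exists p].
have [D [psi [D0 psi1 psiP]]] := sofic_pointwise FN (sN B cB) e60.
have Sc : density R (~: S) < e / 6.
  rewrite densityC // ltrBlDr -ltrBlDl /density ltr_pdivlMr ?ltr0n //.
have C0 : (0 < #|{: C1 * C2 * D}|)%N by rewrite !card_prod !muln_gt0 C10 C20.
exists (C1 * C2 * D)%type, (wreath_perm phi s pi_ psi); split=> //.
- apply/permP => -[[c1 c2] d].
  by rewrite wreath_permE /= phi1 s1 amalg_map1 psi1 !perm1.
- move=> p q pF qF.
  pose bad1 := [set c | phi (p.2 * q.2)%g c != (phi q.2 * phi p.2)%g c]
    :|: phi q.2 @^-1: (~: S) :|: (phi q.2 * phi p.2)%g @^-1: (~: S).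
  pose bad := [set c : C1 * C2 | c.1 \in bad1]
    :|: [set c : C1 * C2 | c.2 \in [set c | ~~ sofic_at FH s c]].
  apply: (@le_lt_trans _ _ (density R bad + e / 6)).
    apply: density_fibre => [|[c1 c2]]; first exact: ltW.
    rewrite !inE /= !negb_or !negbK permM => /andP[/andP[/andP[/eqP phic S1] S2] sc].
    apply: le_trans (ltW psiP); apply: densityS; apply/fintype.subsetP => d.
    rewrite !inE; apply: contra => psd; rewrite permM; apply/eqP.
    exact: (wreath_permM orb (FHP _ pF) (FHP _ qF) (suppE _ qF) (suppaE _ _ pF qF)
      (fun c => FNP c _ pF) (fun c => FNP c _ qF) phic S1 S2 sc psd).
  have b1 : density R bad1 < e / 6 + e / 6 + e / 6.
    apply: le_lt_trans (densityU _ _ _) _; rewrite density_preim.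
    apply: ltrD => //; apply: le_lt_trans (densityU _ _ _) _; rewrite density_preim.
    by apply: ltrD => //; apply: phiM; exact: FHP.
  have := densityU R [set c : C1 * C2 | c.1 \in bad1]
    [set c : C1 * C2 | c.2 \in [set c | ~~ sofic_at FH s c]].
  have := density_fst C2 bad1.
  have := density_snd C1 [set c | ~~ sofic_at FH s c].
  by rewrite -/bad; lra.
move=> p pF p1; rewrite hamming1E // ltrD2l ltrN2.
(* A trivial H-part fixes [C1] and [C2], so the motion must come from [D]; a nontrivial one already
   moves [C2]. *)
have [h1|h1] := eqVneq p.2 1%g.
  have n1 : p.1 != 1%g.
    by apply: contra p1; case: (p) h1 => /= n h -> /eqP ->.
  apply: (@le_lt_trans _ _ (density R [set c : C1 * C2 | c.1 \in ~: S] + e / 6)).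
    apply: density_fibre => [|[c1 c2]]; first exact: ltW.
    rewrite !inE negbK /= => cS; apply: le_trans (ltW psiP).
    apply: densityS; apply/fintype.subsetP => d.
    rewrite !inE wreath_permE h1 phi1 s1 !perm1 => /eqP[pd].
    apply/negP => /sofic_at_free /(_ (FNP c1 _ pF)).
    rewrite pd eqxx => pdN; suff : amalg_map (pi_ c1) (p.1 : amalg A X) != 1%g by move/pdN.
    apply: contra n1 => /eqP n1; apply/eqP; apply: amalg_map_eq1 n1.
    by move=> x y xp yp; apply: (pi_inj c1) => //; apply: (suppE p).
  by have := density_fst C2 (~: S); lra.
apply: (@le_lt_trans _ _
    (density R [set c : C1 * C2 | c.2 \in [set c | ~~ sofic_at FH s c]] + 0)).
  apply: density_fibre => // -[c1 c2]; rewrite !inE negbK /= => sc.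
  rewrite (_ : [set _ | _] = finset.set0) ?density0 //.
  apply/finset.setP => d; rewrite !inE wreath_permE; apply/negbTE.
  by rewrite !xpair_eqE !negb_and (sofic_at_free sc _ h1) ?FHP ?orbT.
by have := density_snd C1 [set c | ~~ sofic_at FH s c]; lra.
Qed.

(** The singleton of 1 is an invariant Folner set. *)
Lemma amenable_trivial (G : groupType) :
  amenable R (subgroup (@trivial_subgroup G)).
Proof.
move=> F e e0; exists [fset 1%g]%fset; first by apply/fset0Pn; exists 1%g; rewrite inE.
have sub1 (x y : subgroup (@trivial_subgroup G)) : x = y.
  by apply: val_inj; rewrite (eqP (valP x)) (eqP (valP y)).
move=> g _ /=.
have -> : [fset (g * k)%g | k in [fset 1%g]]%fset = [fset 1%g]%fset.
  apply/fsetP => x; rewrite (sub1 x 1%g) fset11; apply/imfsetP.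
  by exists 1%g; [rewrite /= inE|exact: sub1].
by rewrite fsetDv fsetUid cardfs0 cardfs1 mulr1.
Qed.

End Wreath.

Local Open Scope classical_set_scope.

Theorem theorem3p7 (R : realType) :
  (forall (G H : groupType) (A : groupClosed G) (X : choiceType)
          (alpha : laction H X),
      countable [set: G] ->
      sofic R H ->
      sofic_action R alpha ->
      (forall I : choiceType, countable [set: I] -> sofic R (amalg A I)) ->
      sofic R (amalgamated_wreath A alpha))
  /\
  (forall (G H : groupType) (X : choiceType) (alpha : laction H X),
      sofic R G ->
      sofic R H ->
      sofic_action R alpha ->
      sofic R (free_wreath G alpha))
  /\
  (forall (G H : groupType) (A : groupClosed G) (X : choiceType)
          (alpha : laction H X),
      sofic R G ->
      sofic R H ->
      sofic_action R alpha ->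
      amenable R (subgroup A) ->
      sofic R (amalgamated_wreath A alpha)).
Proof.
have amenable_case (G H : groupType) (A : groupClosed G) (X : choiceType)
    (alpha : laction H X) : sofic R G -> sofic R H -> sofic_action R alpha ->
    amenable R (subgroup A) -> sofic R (amalgamated_wreath A alpha).
  move=> sG sH sact aA; apply: sofic_wreath => // [|I]; first exact: sG.1.
  exact: sofic_amalg.
split; first by move=> G H A X alpha; exact: sofic_wreath.
split; last exact: amenable_case.
by move=> G H X alpha sG sH sact; apply: amenable_case => //; exact: amenable_trivial.
Qed.
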